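(* Let $S^7=\{y\in\mathbb{R}^8:\|y\|=1\}$ with coordinates $y=(y_0,\dots,y_7)$, and let $Y_2,\dots,Y_7$ be the vector fields tangent to $S^7$ given by $$Y_2=-y_2\partial_{y_0}+y_3\partial_{y_1}+y_0\partial_{y_2}-y_1\partial_{y_3}-y_6\partial_{y_4}+y_7\partial_{y_5}+y_4\partial_{y_6}-y_5\partial_{y_7},$$ $$Y_3=-y_3\partial_{y_0}-y_2\partial_{y_1}+y_1\partial_{y_2}+y_0\partial_{y_3}+y_7\partial_{y_4}+y_6\partial_{y_5}-y_5\partial_{y_6}-y_4\partial_{y_7},$$ $$Y_4=-y_4\partial_{y_0}+y_5\partial_{y_1}+y_6\partial_{y_2}-y_7\partial_{y_3}+y_0\partial_{y_4}-y_1\partial_{y_5}-y_2\partial_{y_6}+y_3\partial_{y_7},$$ $$Y_5=-y_5\partial_{y_0}-y_4\partial_{y_1}-y_7\partial_{y_2}-y_6\partial_{y_3}+y_1\partial_{y_4}+y_0\partial_{y_5}+y_3\partial_{y_6}+y_2\partial_{y_7},$$ $$Y_6=-y_6\partial_{y_0}+y_7\partial_{y_1}-y_4\partial_{y_2}+y_5\partial_{y_3}+y_2\partial_{y_4}-y_3\partial_{y_5}+y_0\partial_{y_6}-y_1\partial_{y_7},$$ $$Y_7=-y_7\partial_{y_0}-y_6\partial_{y_1}+y_5\partial_{y_2}+y_4\partial_{y_3}-y_3\partial_{y_4}-y_2\partial_{y_5}+y_1\partial_{y_6}+y_0\partial_{y_7}.$$ Then the subbundle $\mathcal{H}=\mathrm{span}\{Y_2,\dots,Y_7\}$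 of $TS^7$ is a bracket generating distribution of rank $6$ and step $2$.
   Context: For a smooth distribution $\mathcal{H}\subset TM$ (a smooth subbundle) put $\mathcal{H}^1=\mathcal{H}$ and $\mathcal{H}^{r+1}=[\mathcal{H}^r,\mathcal{H}]+\mathcal{H}^r$ for $r\ge1$, where brackets are taken of local smooth sections. $\mathcal{H}$ is bracket generating if for every $x\in M$ there is $r(x)\ge1$ with $\mathcal{H}^{r(x)}_x=T_xM$. The step of $\mathcal{H}$ is the least $r$ such that $\mathcal{H}^r_x=T_xM$ (here, for all $x$). The span is taken over smooth functions, i.e. $\mathcal{H}_y=\mathrm{span}_{\mathbb{R}}\{Y_2(y),\dots,Y_7(y)\}$ at each $y\in S^7$. *)

(* Defs.v *)
From HB Require Import structures.
From mathcomp Require Import all_boot all_order all_algebra.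
From mathcomp Require Import all_classical all_reals all_analysis.

Set Implicit Arguments.
Unset Strict Implicit.
Unset Printing Implicit Defensive.

Import Order.TTheory GRing.Theory Num.Theory.
Import numFieldNormedType.Exports.

Local Open Scope classical_set_scope.
Local Open Scope ring_scope.

Section Euclidean.
Context {R : realType} {n : nat}.
Implicit Types u v y : 'rV[R]_n.

Definition dot u v : R := \sum_(i < n) u 0 i * v 0 i.

(* The library norm on 'rV[R]_n is the sup norm, hence this definition. *)
Definition enorm y : R := Num.sqrt (dot y y).

Definition unit_sphere : set 'rV[R]_n := [set y | enorm y = 1].

Definition sphere_tangent y : set 'rV[R]_n := [set v | dot v y = 0].

End Euclidean.

Section Smooth.
Context {R : realType} {V W : normedModType R}.

Fixpoint Ck (k : nat) (U : set V) (f : V -> W) : Prop :=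
  match k with
  | 0 => forall x, U x -> {for x, continuous f}
  | k'.+1 => (forall x, U x -> differentiable f x) /\
             (forall v : V, Ck k' U (fun x => 'D_v f x))
  end.

Definition smooth_on (U : set V) (f : V -> W) : Prop := forall k, Ck k U f.

Definition lie_bracket (X Y : V -> V) : V -> V :=
  fun x => 'D_(X x) Y x - 'D_(Y x) X x.

End Smooth.

(* M is an embedded submanifold of R^n and T x is its tangent space at x.  A
   local section over M `&` U of a subbundle of T is represented by a map X
   that is smooth on the open set U of R^n; only the values of X on M `&` U
   matter.  Every smooth local section has such a representative near each
   point, and the values on M of the ambient Lie bracket of two
   representatives depend only on the sections they represent, because these
   are tangent to M. *)
Section Distribution.
Context {R : realType} {n : nat}.
Local Notation E := 'rV[R]_n.
Context (M : set E) (T : E -> set E) (D : E -> {vspace E}).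

Definition local_section (U : set E) (X : E -> E) : Prop :=
  smooth_on U X /\ (forall y, M y -> U y -> X y \in D y).

Definition distribution_of_rank (k : nat) : Prop :=
  (forall x, M x -> forall v, v \in D x -> T x v) /\
  (forall x, M x ->
     exists (U : set E) (F : 'I_k -> E -> E),
       [/\ open U, U x, (forall i, smooth_on U (F i)) &
           forall y, M y -> U y -> basis_of (D y) [seq F i y | i : 'I_k]]).

(* bracket_sections m U consists of the sections over M `&` U of the (m+1)-st
   term of the flag of D.  Sums of brackets suffice: they are closed under
   multiplication by smooth functions modulo the previous term, since
   f [A, B] = [f A, B] + (B f) A. *)
Fixpoint bracket_sections (m : nat) (U : set E) (X : E -> E) : Prop :=
  match m with
  | 0 => local_section U X
  | m'.+1 => smooth_on U X /\
      exists (N : nat) (A B : 'I_N -> E -> E) (Z : E -> E),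
        [/\ (forall i, bracket_sections m' U (A i)),
            (forall i, local_section U (B i)),
            bracket_sections m' U Z &
            forall y, M y -> U y ->
              X y = \sum_(i < N) lie_bracket (A i) (B i) y + Z y]
  end.

(* flag_fiber r x is the fibre at x of the r-th term of the flag; it is only
   meaningful for r >= 1. *)
Definition flag_fiber (r : nat) (x : E) : set E :=
  [set v | exists (U : set E) (X : E -> E),
     [/\ open U, U x, bracket_sections r.-1 U X & X x = v]].

Definition bracket_generating : Prop :=
  forall x, M x -> exists r, (1 <= r)%N /\ flag_fiber r x = T x.

Definition has_step (r : nat) : Prop :=
  [/\ (1 <= r)%N,
      (forall x, M x -> flag_fiber r x = T x) &
      forall s, (1 <= s)%N -> (forall x, M x -> flag_fiber s x = T x) ->
        (r <= s)%N].

End Distribution.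

Section SevenSphere.
Context {R : realType}.
Implicit Type y : 'rV[R]_8.

Local Notation "y `[ i ]" := (y 0 (inord i : 'I_8))
  (at level 1, format "y `[ i ]").

Definition row8 (s : seq R) : 'rV[R]_8 := \row_(j < 8) s`_j.

Definition Y2 y := row8
  [:: - y`[2]; y`[3]; y`[0]; - y`[1]; - y`[6]; y`[7]; y`[4]; - y`[5]].
Definition Y3 y := row8
  [:: - y`[3]; - y`[2]; y`[1]; y`[0]; y`[7]; y`[6]; - y`[5]; - y`[4]].
Definition Y4 y := row8
  [:: - y`[4]; y`[5]; y`[6]; - y`[7]; y`[0]; - y`[1]; - y`[2]; y`[3]].
Definition Y5 y := row8
  [:: - y`[5]; - y`[4]; - y`[7]; - y`[6]; y`[1]; y`[0]; y`[3]; y`[2]].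
Definition Y6 y := row8
  [:: - y`[6]; y`[7]; - y`[4]; y`[5]; y`[2]; - y`[3]; y`[0]; - y`[1]].
Definition Y7 y := row8
  [:: - y`[7]; - y`[6]; y`[5]; y`[4]; - y`[3]; - y`[2]; y`[1]; y`[0]].

Definition H7 y : {vspace 'rV[R]_8} :=
  <<[:: Y2 y; Y3 y; Y4 y; Y5 y; Y6 y; Y7 y]>>%VS.

End SevenSphere.

(* Main.v *)
Require Import Defs.
From HB Require Import structures.
From mathcomp Require Import all_boot all_order all_algebra.
From mathcomp Require Import all_classical all_reals all_analysis.
From mathcomp Require Import ring.

Set Implicit Arguments.
Unset Strict Implicit.
Unset Printing Implicit Defensive.

Import Order.TTheory GRing.Theory Num.Theory.
Import numFieldNormedType.Exports.

Local Open Scope classical_set_scope.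
Local Open Scope ring_scope.

(** The fields Y2, ..., Y7 complete the Hopf field Y1 to a Clifford system: at a
    unit vector y the vectors y, Y1 y, ..., Y7 y are orthonormal, so H is the
    orthogonal complement of Y1 in the tangent bundle, i.e. the standard contact
    distribution.  Since Y1 and Y2 anticommute and square to -1, the linear field
    Y1 o Y2 is again a section of H and its bracket with Y2 is -2 Y1; hence one
    bracket suffices at every point.  Conversely brackets of fields tangent to
    the sphere are tangent: differentiating <X z, z> = 0 along the sphere gives
    <D_v X, x> = - <X x, v>, which is symmetric when v is another tangent field. *)

(** * Bilinearity and positivity of the Euclidean inner product *)

Section DotProduct.
Context {R : realType} {n : nat}.
Implicit Types (u v w : 'rV[R]_n) (a : R).

Lemma dotC u v : dot u v = dot v u.
Proof. by apply: eq_bigr => i _; rewrite mulrC. Qed.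

Lemma dotDl u v w : dot (u + v) w = dot u w + dot v w.
Proof. by rewrite -big_split; apply: eq_bigr => i _; rewrite mxE mulrDl. Qed.

Lemma dotZl a u v : dot (a *: u) v = a * dot u v.
Proof. by rewrite /dot mulr_sumr; apply: eq_bigr => i _; rewrite mxE mulrA. Qed.

Lemma dotDr u v w : dot w (u + v) = dot w u + dot w v.
Proof. by rewrite !(dotC w) dotDl. Qed.

Lemma dotZr a u v : dot u (a *: v) = a * dot u v.
Proof. by rewrite !(dotC u) dotZl. Qed.

Lemma dot_suml (I : Type) (r : seq I) (F : I -> 'rV[R]_n) v :
  dot (\sum_(i <- r) F i) v = \sum_(i <- r) dot (F i) v.
Proof.
apply: (big_morph (fun u => dot u v)) => [u w|]; first exact: dotDl.
by rewrite /dot big1 // => i _; rewrite mxE mul0r.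
Qed.

Lemma dot_ge0 u : 0 <= dot u u.
Proof. by apply: sumr_ge0 => i _; rewrite -expr2 sqr_ge0. Qed.

Lemma unit_sphereE u : unit_sphere u <-> dot u u = 1.
Proof.
rewrite /unit_sphere /enorm /=; split=> [h|->]; last exact: sqrtr1.
by rewrite -(sqr_sqrtr (dot_ge0 u)) h expr1n.
Qed.

End DotProduct.

(** * Derivatives along the sphere and brackets of tangent fields *)

Section SphereBracket.
Context {R : realType} {n : nat}.
Local Notation E := 'rV[R]_n.

Lemma differentiable_dot_id (X : E -> E) x : differentiable X x ->
  differentiable (fun z => dot (X z) z) x.
Proof.
move=> dX; rewrite /dot.
rewrite (_ : (fun _ => _) = \sum_(i < n) (fun z : E => X z 0 i * z 0 i)); last first.
  by apply/funext => z; rewrite fct_sumE.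
apply: differentiable_sum => i; apply: differentiableM.
  apply: (@differentiable_comp _ _ _ _ X (fun M : E => M 0 i)) => //.
  exact: differentiable_coord.
exact: differentiable_coord.
Qed.

Lemma derive_dot_id (X : E -> E) x v : differentiable X x ->
  'D_v (fun z => dot (X z) z) x = dot ('D_v X x) x + dot (X x) v.
Proof.
move=> dX; have dXv : derivable X x v := diff_derivable dX.
rewrite /dot (_ : (fun _ => _) = \sum_(i < n) (fun z : E => X z 0 i * z 0 i)); last first.
  by apply/funext => z; rewrite fct_sumE.
have dXi i : derivable (fun z => X z 0 i) x v by move/derivable_mxP : dXv.
have did i : derivable (fun z : E => z 0 i) x v.
  by apply: diff_derivable; exact: differentiable_coord.
(* Read off entrywise from the derivative of the identity. *)
have Did i : 'D_v (fun z : E => z 0 i) x = v 0 i.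
  have := derive_mx (@derivable_id R E x v).
  by move=> /(congr1 (fun M : E => M 0 i)); rewrite derive_id => ->; rewrite mxE.
rewrite derive_sum => [|i]; last exact: derivableM.
rewrite -big_split; apply: eq_bigr => i _ /=.
by rewrite deriveM // derive_mx // mxE addrC Did; congr (_ + _); exact: mulrC.
Qed.

(* The rational parametrization of the circle through x with velocity 2v. *)
Definition sphere_arc (x v : E) (t : R) : E :=
  ((1 - dot v v * t ^+ 2) / (1 + dot v v * t ^+ 2)) *: x +
  (2 * t / (1 + dot v v * t ^+ 2)) *: v.

Lemma sphere_arc_denom_gt0 (v : E) t : 0 < 1 + dot v v * t ^+ 2.
Proof. by rewrite ltr_pwDl// mulr_ge0 ?dot_ge0 ?sqr_ge0. Qed.

Lemma sphere_arc0 x v : sphere_arc x v 0 = x.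
Proof. by rewrite /sphere_arc expr0n !mulr0 mul0r subr0 addr0 divr1 scale0r addr0 scale1r. Qed.

(** As x and v are orthogonal, with c = [dot v v] the squared norm is ((1 - c t^2)^2 + 4 c t^2) / (1
    + c t^2)^2 = 1. *)
Lemma unit_sphere_arc x v t : unit_sphere x -> sphere_tangent x v ->
  unit_sphere (sphere_arc x v t).
Proof.
move=> /unit_sphereE xx vx; apply/unit_sphereE.
have := sphere_arc_denom_gt0 v t => /lt0r_neq0.
rewrite /sphere_arc !(dotDl, dotDr, dotZl, dotZr) (dotC x v) vx xx => d0.
by field.
Qed.

Lemma is_derive_sphere_arc x v :
  is_derive (0 : R) 1 (sphere_arc x v) (2 *: v).
Proof.
(* [q] is the common denominator; q(0) = 1 and q'(0) = 0, so only the numerators contribute to the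
   velocity at 0. *)
set c := dot v v; pose q : R -> R := cst 1 + cst c * id ^+ 2.
have q0 : q 0 = 1 by rewrite /q /= !fctE /= expr0n mulr0 addr0.
have dq : is_derive (0 : R) 1 q 0.
  by rewrite /q; apply: is_derive_eq; rewrite !fctE /GRing.scale/= !expr0n /=; ring.
have dqV : is_derive (0 : R) 1 (fun t => (q t)^-1) 0.
  have q0' : q 0 != 0 by rewrite q0 oner_neq0.
  apply: DeriveDef; first exact: derivableV.
  by rewrite deriveV // derive_val scaler0.
have arcE i : (fun t => sphere_arc x v t 0 i) =
   (cst (x 0 i) * (cst 1 - cst c * id ^+ 2) + cst (2 * v 0 i) * id) * (fun t => (q t)^-1).
  apply/funext => t; rewrite !fctE /sphere_arc !mxE /q !fctE -/c; ring.
have darc i : is_derive (0 : R) 1 (fun t => sphere_arc x v t 0 i) (2 * v 0 i).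
  rewrite arcE; apply: is_derive_eq; rewrite /= !fctE q0 /GRing.scale/= !expr0n invr1 /=.
  ring.
have arcD : derivable (sphere_arc x v) 0 1.
  by apply/derivable_mxP => j i; rewrite (ord1 j).
apply: DeriveDef => //; rewrite derive_mx //; apply/rowP => i.
by rewrite !mxE derive_val.
Qed.

(** For small t the arc stays in [U] and on the sphere, so g vanishes along it; by the chain rule
    the derivative at 0 is twice ['D_v g x]. *)
Lemma derive_eq0_on_sphere (U : set E) (g : E -> R) x v :
  open U -> U x -> unit_sphere x -> sphere_tangent x v ->
  differentiable g x -> (forall y, unit_sphere y -> U y -> g y = 0) ->
  'D_v g x = 0.
Proof.
move=> oU Ux Sx Tv dg g0.
have dc := is_derive_sphere_arc x v.
have /derivable1_diffP dcd : derivable (sphere_arc x v) 0 1 by [].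
have dg' : differentiable g (sphere_arc x v 0) by rewrite sphere_arc0.
have gc : \forall t \near (0 : R), g (sphere_arc x v t) = 0.
  have : \forall t \near (0 : R), U (sphere_arc x v t).
    apply: (differentiable_continuous dcd).
    by rewrite sphere_arc0; exact: open_nbhs_nbhs.
  by apply: filterS => t; apply: g0; exact: unit_sphere_arc.
have : 'D_1 (g \o sphere_arc x v) (0 : R) = 0.
  by rewrite (near_eq_derive (g := cst 0) _ gc) derive_cst.
rewrite deriveE; last exact: differentiable_comp.
have dc1 : 'd (sphere_arc x v) (0 : R) 1 = 2 *: v by rewrite -deriveE // derive_val.
rewrite diff_comp //= dc1 sphere_arc0 linearZ/= -deriveE //.
by move=> /eqP; rewrite mulf_eq0 pnatr_eq0 => /eqP.
Qed.

Lemma dot_derive_tangent (U : set E) (X : E -> E) x v :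
  open U -> U x -> unit_sphere x -> sphere_tangent x v ->
  differentiable X x ->
  (forall y, unit_sphere y -> U y -> sphere_tangent y (X y)) ->
  dot ('D_v X x) x = - dot (X x) v.
Proof.
move=> oU Ux Sx Tv dX TX; apply/eqP; rewrite -addr_eq0 -derive_dot_id //.
apply/eqP; apply: (derive_eq0_on_sphere oU) => //.
exact: differentiable_dot_id.
Qed.

Lemma sphere_tangent_lie_bracket (U : set E) (X Y : E -> E) x :
  open U -> U x -> unit_sphere x ->
  differentiable X x -> differentiable Y x ->
  (forall y, unit_sphere y -> U y -> sphere_tangent y (X y)) ->
  (forall y, unit_sphere y -> U y -> sphere_tangent y (Y y)) ->
  sphere_tangent x (lie_bracket X Y x).
Proof.
move=> oU Ux Sx dX dY TX TY.
rewrite /sphere_tangent /= /lie_bracket -scaleN1r dotDl dotZl.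
rewrite (dot_derive_tangent oU) ?(dot_derive_tangent (X := X) oU) //;
  [|exact: TY|exact: TX].
(* What is left is - <Y x, X x> + <X x, Y x>. *)
by rewrite (dotC (X x)); ring.
Qed.

End SphereBracket.

(** * Smoothness and brackets of linear vector fields *)

Section LinearFields.
Context {R : realType} {n : nat}.
Local Notation E := 'rV[R]_n.

Lemma smooth_on_cst (V W : normedModType R) (U : set V) (w : W) :
  smooth_on U (fun=> w).
Proof.
(* The induction is over all constants w, since the derivative is another constant, 0. *)
move=> k; elim: k w => [|k IHk] w /=; first by move=> x _; exact: cst_continuous.
split=> [x _|v]; first exact: differentiable_cst.
under eq_fun do rewrite derive_cst; exact: IHk.
Qed.

(** In finite dimension f is a sum of coordinate functions times the fixed vectors f(e_i). *)
Lemma differentiable_linear_rV (f : E -> E) x : linear f -> differentiable f x.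
Proof.
move=> lf; pose fL : {linear E -> E} := HB.pack f (GRing.isLinear.Build _ _ _ _ f lf).
rewrite (_ : f = \sum_(i < n) (fun y : E => y 0 i *: f (delta_mx 0 i))).
  apply: differentiable_sum => i; apply: differentiableZl.
  exact: differentiable_coord.
apply/funext => y; rewrite fct_sumE [in LHS](row_sum_delta y) -[f]/(fL : E -> E).
by rewrite linear_sum; apply: eq_bigr => i _; rewrite linearZ.
Qed.

Lemma derive_linear_rV (f : E -> E) x v : linear f -> 'D_v f x = f v.
Proof.
move=> lf; pose fL : {linear E -> E} := HB.pack f (GRing.isLinear.Build _ _ _ _ f lf).
rewrite deriveE; last exact: differentiable_linear_rV.
rewrite -[f]/(fL : E -> E) diff_lin // => y.
exact/differentiable_continuous/differentiable_linear_rV.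
Qed.

(** Each directional derivative of f is constant, which reduces all higher orders to
    [smooth_on_cst]. *)
Lemma smooth_on_linear (U : set E) (f : E -> E) : linear f -> smooth_on U f.
Proof.
move=> lf; case=> [|k] /=.
  by move=> x _; exact/differentiable_continuous/differentiable_linear_rV.
split=> [x _|v]; first exact: differentiable_linear_rV.
under eq_fun do rewrite derive_linear_rV //; exact: smooth_on_cst.
Qed.

Lemma linear_scale (f : E -> E) (a : R) u : linear f -> f (a *: u) = a *: f u.
Proof.
move=> lf; pose fL : {linear E -> E} := HB.pack f (GRing.isLinear.Build _ _ _ _ f lf).
exact: (linearZ_LR fL).
Qed.

Lemma lie_bracket_linear (f g : E -> E) x : linear f -> linear g ->
  lie_bracket f g x = g (f x) - f (g x).
Proof. by move=> lf lg; rewrite /lie_bracket !derive_linear_rV. Qed.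

End LinearFields.

(** * The orthonormal Clifford frame of the seven-sphere *)

Section Frame.
Context {R : realType}.
Local Notation E := 'rV[R]_8.
Implicit Types (u v y : E) (i j : 'I_8).

Local Notation "y `[ i ]" := (y 0 (inord i : 'I_8))
  (at level 1, format "y `[ i ]").

(** The Hopf field: multiplication by i on C^4, with complex coordinates y_{2k} + i y_{2k+1}. *)
Definition Y1 y : E := row8
  [:: - y`[1]; y`[0]; - y`[3]; y`[2]; - y`[5]; y`[4]; - y`[7]; y`[6]].

Lemma eq_row8 u v : (forall k, (k < 8)%N -> u`[k] = v`[k]) -> u = v.
Proof. by move=> uv; apply/rowP => i; rewrite -(inord_val i) uv. Qed.

Lemma dot8E u v : dot u v =
  u`[0] * v`[0] + u`[1] * v`[1] + u`[2] * v`[2] + u`[3] * v`[3] +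
  u`[4] * v`[4] + u`[5] * v`[5] + u`[6] * v`[6] + u`[7] * v`[7].
Proof.
have -> : dot u v = \sum_(0 <= k < 8) u`[k] * v`[k].
  by rewrite big_mkord; apply: eq_bigr => i _; rewrite inord_val.
by rewrite !big_nat_recr //= big_nil add0r.
Qed.

(** Starting with [id] makes y the vector of index 0 and gives each [Yk] the index k. The default of
    [nth] is never reached. *)
Definition frame (i : 'I_8) : E -> E :=
  nth id [:: id; Y1; Y2; Y3; Y4; Y5; Y6; Y7] i.

Lemma linear_frame i : linear (frame i).
Proof.
case: i => -[|[|[|[|[|[|[|[|//]]]]]]]] lt_i8 a u v; rewrite /frame /= //.
all: apply: eq_row8 => -[|[|[|[|[|[|[|[|//]]]]]]]] lt_k8.
all: by rewrite !mxE !inordK //= ?mulrN ?opprD.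
Qed.

(** Each frame vector is a signed permutation of the coordinates of y, so all 64 cases are quadratic
    identities; off the diagonal the products cancel in pairs. *)
Lemma dot_frame i j y : dot (frame i y) (frame j y) = dot y y *+ (i == j).
Proof.
case: i => -[|[|[|[|[|[|[|[|//]]]]]]]] ?; case: j => -[|[|[|[|[|[|[|[|//]]]]]]]] ?.
all: rewrite -val_eqE /= ?mulr1n ?mulr0n /frame /= !dot8E.
all: rewrite ?mxE ?inordK //=; ring.
Qed.

Lemma dot_frame_unit i j y : unit_sphere y ->
  dot (frame i y) (frame j y) = (i == j)%:R.
Proof. by move=> /unit_sphereE yy; rewrite dot_frame yy. Qed.

(** The frame vectors are the rows of a square matrix M with M M^T = 1; then also M^T M = 1, and v =
    (v M^T) M is the expansion. *)
Lemma frame_expansion y v : unit_sphere y ->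
  v = \sum_i dot v (frame i y) *: frame i y.
Proof.
move=> Sy; pose M : 'M[R]_8 := \matrix_i frame i y.
have MMT : M *m M^T = 1%:M.
  apply/matrixP => i j; rewrite !mxE -(dot_frame_unit i j Sy).
  by apply: eq_bigr => k _; rewrite !mxE.
have MTM := mulmx1C MMT.
rewrite -[LHS]mulmx1 -MTM mulmxA mulmx_sum_row; apply: eq_bigr => i _.
rewrite rowK mxE; congr (_ *: _).
by apply: eq_bigr => k _; rewrite !mxE.
Qed.

(** * The distribution as the orthogonal complement of y and [Y1 y] *)

Definition hframe (i : 'I_6) : E -> E := frame (rshift 2 i).

Lemma hframeE y : [seq hframe i y | i : 'I_6] =
  [:: Y2 y; Y3 y; Y4 y; Y5 y; Y6 y; Y7 y].
Proof. by rewrite /image_mem !enum_ordSl enum_ord0 /=. Qed.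

(** The tuple form is the one that [coord_span] and [freeP] work with. *)
Lemma H7E y : H7 y = <<[tuple hframe i y | i < 6]>>%VS.
Proof. by rewrite /H7 -hframeE. Qed.

Lemma frame_expansion_split y v : unit_sphere y ->
  v = dot v y *: y + dot v (Y1 y) *: Y1 y +
      \sum_(i < 6) dot v (hframe i y) *: hframe i y.
Proof.
move=> Sy; rewrite [LHS](frame_expansion v Sy).
by rewrite (@big_split_ord _ _ _ 2 6) /= !big_ord_recl big_ord0 addr0.
Qed.

(** The generators are orthogonal to y and [Y1 y]; conversely, these two conditions kill the
    non-horizontal terms of the frame expansion. *)
Lemma mem_H7P y v : unit_sphere y ->
  reflect (dot v y = 0 /\ dot v (Y1 y) = 0) (v \in H7 y).
Proof.
move=> Sy; rewrite H7E; apply: (iffP idP) => [/coord_span ->|[v0 v1]].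
  rewrite !dot_suml; split; apply: big1 => i _;
    rewrite dotZl -tnth_nth tnth_mktuple.
    by rewrite (dot_frame_unit _ ord0) // mulr0.
  by rewrite (dot_frame_unit _ (@Ordinal 8 1 isT)) // mulr0.
rewrite (frame_expansion_split v Sy) v0 v1 !scale0r !add0r.
apply: memv_suml => i _; apply/memvZ/memv_span; apply/tnthP; exists i.
by rewrite tnth_mktuple.
Qed.

(** Pairing a vanishing combination with [hframe i y] isolates its i-th coefficient. *)
Lemma free_hframe y : unit_sphere y -> free [seq hframe i y | i : 'I_6].
Proof.
move=> Sy; apply/(@freeP _ _ _ [tuple hframe i y | i < 6]) => k k0 i.
have := congr1 (fun u => dot u (hframe i y)) k0.
rewrite dot_suml (bigD1 i) // big1 => [|j ji].
  rewrite -tnth_nth tnth_mktuple dotZl dot_frame_unit // eqxx mulr1 /= addr0 => ->.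
  by rewrite /dot big1 // => j _; rewrite mxE mul0r.
rewrite -tnth_nth tnth_mktuple dotZl dot_frame_unit //.
by rewrite (inj_eq (@rshift_inj 2 6)) (negbTE ji) mulr0.
Qed.

Lemma linear_hframe (i : 'I_6) : linear (hframe i).
Proof. exact: linear_frame. Qed.

(** * Clifford relations and the bracket that produces [Y1] *)

Lemma linear_Y1 : linear (Y1 : E -> E).
Proof. exact: (linear_frame (@Ordinal 8 1 isT)). Qed.

Lemma linear_Y2 : linear (Y2 : E -> E).
Proof. exact: (linear_frame (@Ordinal 8 2 isT)). Qed.

Lemma linear_Y1Y2 : linear (fun y : E => Y1 (Y2 y)).
Proof. by move=> a u v; rewrite linear_Y2 linear_Y1. Qed.

Lemma Y2_Y2 y : Y2 (Y2 y) = - y.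
Proof.
apply: eq_row8 => -[|[|[|[|[|[|[|[|//]]]]]]]] lt_k8.
all: by rewrite !mxE !inordK //= ?mxE ?inordK //= ?opprK.
Qed.

Lemma Y2_Y1 y : Y2 (Y1 y) = - Y1 (Y2 y).
Proof.
apply: eq_row8 => -[|[|[|[|[|[|[|[|//]]]]]]]] lt_k8.
all: by rewrite !mxE !inordK //= ?mxE ?inordK //= ?opprK.
Qed.

Lemma hframe_in_H7 (i : 'I_6) y : unit_sphere y -> hframe i y \in H7 y.
Proof.
by move=> Sy; rewrite H7E; apply: memv_span; apply/tnthP; exists i; rewrite tnth_mktuple.
Qed.

(** Both orthogonality conditions are coordinate identities; they reflect that [Y1] is skew and
    orthogonal: <Y1 Y2 y, y> = - <Y2 y, Y1 y> and <Y1 Y2 y, Y1 y> = <Y2 y, y>. *)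
Lemma Y1Y2_in_H7 y : unit_sphere y -> Y1 (Y2 y) \in H7 y.
Proof.
by move=> Sy; apply/mem_H7P => //; split; rewrite dot8E !mxE !inordK //= ?mxE ?inordK //=; ring.
Qed.

(** The factor c sits inside the first field because [bracket_sections] takes sums of brackets
    without coefficients. *)
Lemma lie_bracket_Y2_Y1Y2 (c : R) y :
  lie_bracket (fun y => c *: Y2 y) (fun y => Y1 (Y2 y)) y = (- 2 * c) *: Y1 y.
Proof.
rewrite lie_bracket_linear; [|move=> a u v|exact: linear_Y1Y2].
  have Y1N : Y1 (- y) = - Y1 y by rewrite -scaleN1r (linear_scale _ _ linear_Y1) scaleN1r.
  rewrite (linear_scale _ _ linear_Y2) (linear_scale _ _ linear_Y1) Y2_Y1 !Y2_Y2 Y1N.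
  by rewrite opprK scalerN -opprD -scalerDl -scaleNr; congr (_ *: _); ring.
by rewrite linear_Y2 scalerDr !scalerA mulrC.
Qed.

Lemma H7_sub_tangent y v : unit_sphere y -> v \in H7 y -> sphere_tangent y v.
Proof. by move=> Sy /(mem_H7P _ Sy)[]. Qed.

(** * Rank and flag of the distribution *)

Lemma local_section_H7_linear (f : E -> E) : linear f ->
  (forall y, unit_sphere y -> f y \in H7 y) ->
  local_section unit_sphere H7 setT f.
Proof. by move=> lf Hf; split=> [|y Sy _]; [exact: smooth_on_linear|exact: Hf]. Qed.

Lemma H7_distribution_of_rank :
  distribution_of_rank unit_sphere sphere_tangent (@H7 R) 6.
Proof.
split=> [x Sx v|x Sx]; first exact: H7_sub_tangent.
exists setT, hframe; split=> //; first exact: openT.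
  by move=> i; apply: smooth_on_linear; exact: linear_hframe.
by move=> y Sy _; rewrite /basis_of free_hframe // andbT hframeE.
Qed.

Lemma flag_fiber2_H7 x : unit_sphere x ->
  flag_fiber unit_sphere (@H7 R) 2 x = sphere_tangent x.
Proof.
move=> Sx; apply/seteqP; split=> v.
  move=> [U [X [oU Ux [_ [N [A [B [Z [secA secB secZ XE]]]]]] <-]]].
  have tangent_section W : local_section unit_sphere H7 U W ->
      forall y, unit_sphere y -> U y -> sphere_tangent y (W y).
    by move=> [_ HW] y Sy Uy; exact/H7_sub_tangent/HW.
  have diff_section W : local_section unit_sphere H7 U W -> differentiable W x.
    (* Order 1 of smoothness contains differentiability on [U]. *)
    by move=> [/(_ 1)[dW _] _]; exact: dW.
  rewrite /sphere_tangent /= XE // dotDl dot_suml big1 => [|i _].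
    by rewrite add0r (tangent_section _ secZ).
  apply: (sphere_tangent_lie_bracket oU) => //.
  - exact/diff_section/secA.
  - exact/diff_section/secB.
  - exact/tangent_section/secA.
  - exact/tangent_section/secB.
rewrite /sphere_tangent /= => vx.
pose c := dot v (Y1 x).
(* Extends the horizontal part of v to a linear section, with coefficients frozen at x. *)
pose Z y := \sum_(i < 6) dot v (hframe i x) *: hframe i y.
have lZ : linear Z.
  move=> a u w; rewrite /Z scaler_sumr -big_split; apply: eq_bigr => i _.
  by rewrite linear_hframe scalerDr !scalerA [a * _]mulrC.
exists setT, (fun y => c *: Y1 y + Z y); split=> //; first exact: openT.
  split.
    apply: smooth_on_linear => a u w.
    by rewrite lZ linear_Y1 !scalerDr !scalerA [a * c]mulrC addrACA.
  (* A single bracket: the factor - c / 2 offsets the - 2 in [Y2, Y1 Y2] = - 2 Y1 and leaves c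
     Y1. *)
  exists 1%N, (fun _ y => (- c / 2) *: Y2 y), (fun _ y => Y1 (Y2 y)), Z; split.
  - move=> _; apply: local_section_H7_linear.
      by move=> a u w; rewrite linear_Y2 scalerDr !scalerA [a * _]mulrC.
    by move=> y Sy; apply: memvZ; exact: (hframe_in_H7 ord0).
  - by move=> _; apply: local_section_H7_linear; [exact: linear_Y1Y2|exact: Y1Y2_in_H7].
  - apply: local_section_H7_linear => // y Sy.
    by apply: memv_suml => i _; apply: memvZ; exact: hframe_in_H7.
  move=> y Sy _; rewrite big_ord1 lie_bracket_Y2_Y1Y2; congr (_ *: _ + _).
  by field.
by rewrite [RHS](frame_expansion_split v Sx) vx scale0r add0r.
Qed.

Lemma flag_fiber1_sub_H7 x v : unit_sphere x ->
  flag_fiber unit_sphere (@H7 R) 1 x v -> v \in H7 x.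
Proof. by move=> Sx [U [X [_ Ux [_ HX] <-]]]; exact: HX. Qed.

(** [Y1 x] is tangent to the sphere, but its product with itself is 1, so it is not horizontal. *)
Lemma flag_fiber1_H7_neq x : unit_sphere x ->
  flag_fiber unit_sphere (@H7 R) 1 x <> sphere_tangent x.
Proof.
move=> Sx eqT.
have : sphere_tangent x (Y1 x).
  by rewrite /sphere_tangent /= (dot_frame_unit (@Ordinal 8 1 isT) ord0).
rewrite -eqT => /(flag_fiber1_sub_H7 Sx)/(mem_H7P _ Sx)[_].
rewrite (dot_frame_unit (@Ordinal 8 1 isT) (@Ordinal 8 1 isT)) //.
by move/eqP; rewrite oner_eq0.
Qed.

(** Minimality of the step requires an actual point of the sphere at which step 1 fails. *)
Lemma unit_sphere_delta : unit_sphere (delta_mx 0 0 : E).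
Proof.
apply/unit_sphereE; rewrite /dot (bigD1 0) //= big1 => [|i i0].
  by rewrite mxE !eqxx mulr1 addr0.
by rewrite mxE (negbTE i0) andbF mul0r.
Qed.

End Frame.

Theorem theorem3 (R : realType) :
  [/\ distribution_of_rank (@unit_sphere R 8) (@sphere_tangent R 8) (@H7 R) 6,
      bracket_generating (@unit_sphere R 8) (@sphere_tangent R 8) (@H7 R) &
      has_step (@unit_sphere R 8) (@sphere_tangent R 8) (@H7 R) 2].
Proof.
split; first exact: H7_distribution_of_rank.
  by move=> x Sx; exists 2%N; split=> //; exact: flag_fiber2_H7.
(* Of the candidates s below 2, s = 0 is excluded by 1 <= s, which leaves s = 1 to refute. *)
split=> // [|[//|[|//]] _ eqT]; first exact: flag_fiber2_H7.
by case: (flag_fiber1_H7_neq (@unit_sphere_delta R)); exact/eqT/unit_sphere_delta.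
Qed.
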